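(* There exists an absolute constant $c_0>0$ such that the following holds. Let $n\ge2$ and $A=\mathrm{diag}(\lambda_1,\dots,\lambda_n)$ with $\lambda_1>\lambda_2\ge\dots\ge\lambda_n$, real, and suppose Assumption 1 (context) holds with constant $c_0$. Let $$E=\begin{pmatrix}0&g^T\\ g&0\end{pmatrix},$$ where $g\sim N(0,I_{n-1})$ is a standard Gaussian vector in $\mathbb{R}^{n-1}$, and let $\tilde u_1$ be a unit leading eigenvector of $\tilde A=A+E$. Then with probability $1-O(n^{-2})$, $$|\langle\tilde u_1,e_{j+1}\rangle|\ge\frac{|g_j|}{4(\lambda_1-\lambda_{j+1})}\qquad\text{for all }1\le j\le n-1,$$ where $e_1,\dots,e_n$ is the standard basis. As a consequence, with probability $1-O(n^{-2})$, $\max_{1\le j\le n-1}(\lambda_1-\lambda_{j+1})|\langle\tilde u_1,e_{j+1}\rangle|\ge c\sqrt{\log n}$ for an absolute constant $c>0$.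
   Context: Let $d(\lambda)\in\mathbb{R}^{n-1}$, $[d(\lambda)]_j=1/(\lambda_1-\lambda_{j+1})$; $\|\cdot\|_{p/(p-2)}$ means $\|\cdot\|_\infty$ when $p=2$. Assumption 1 (with constant $c_0$): either (1) there exists $p\in[2,\infty)$ with $\sqrt{p\log n}\,n^{1/p}\|d(\lambda)\|_{p/(p-2)}\le c_0$, or (2) $\log n\,\|d(\lambda)\|_1\le c_0$. *)

(* Defs.v *)
From HB Require Import structures.
From mathcomp Require Import all_boot all_order all_algebra.
From mathcomp Require Import all_classical all_reals all_analysis.
From mathcomp Require Import Rstruct Rstruct_topology.
Set Implicit Arguments. Unset Strict Implicit. Unset Printing Implicit Defensive.
Import Order.TTheory GRing.Theory Num.Theory.
Local Open Scope classical_set_scope.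
Local Open Scope ring_scope.

Notation RR := (Real.sort Rdefinitions.R).

(* Paper index i (1..n) of lambda_i corresponds to [lam (i-1)]. *)
(* [d]_j = 1/(lambda_1 - lambda_{j+1}), j = 1..n-1, i.e. dvec lam j for j in [1, n). *)
Definition dvec (lam : nat -> RR) (j : nat) : RR := (lam 0%N - lam j)^-1.

Definition dnorm_q (n : nat) (lam : nat -> RR) (q : RR) : RR :=
  powR (\sum_(1 <= j < n) powR `|dvec lam j| q) q^-1.

Definition dnorm_inf (n : nat) (lam : nat -> RR) : RR :=
  \big[Num.max/0]_(1 <= j < n) `|dvec lam j|.

Definition dnorm_1 (n : nat) (lam : nat -> RR) : RR :=
  \sum_(1 <= j < n) `|dvec lam j|.

Definition dnorm_p (n : nat) (lam : nat -> RR) (p : RR) : RR :=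
  if p == 2 then dnorm_inf n lam else dnorm_q n lam (p / (p - 2)).

Definition Assumption1 (c0 : RR) (n : nat) (lam : nat -> RR) : Prop :=
  (exists p : RR, 2 <= p /\
     Num.sqrt (p * ln n%:R) * powR n%:R p^-1 * dnorm_p n lam p <= c0)
  \/ ln n%:R * dnorm_1 n lam <= c0.

Definition gext (m : nat) (g : 'I_m -> RR) (j : nat) : RR :=
  if insub j is Some j' then g j' else 0.

(* A~ = diag(lam_1..lam_n) + [[0, g^T]; [g, 0]] *)
Definition Atilde (n : nat) (lam : nat -> RR) (g : 'I_n.-1 -> RR) : 'M[RR]_n :=
  \matrix_(i, k)
    ((if i == k then lam i else 0)
     + (if (i == 0%N :> nat) && (0 < k)%N then gext g k.-1
        else if (k == 0%N :> nat) && (0 < i)%N then gext g i.-1 else 0)).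

Definition unit_leading_eigenvector (n : nat) (M : 'M[RR]_n) (u : 'cV[RR]_n) : Prop :=
  \sum_i (u i 0) ^+ 2 = 1 /\
  exists mu : RR, M *m u = mu *: u /\
    forall (nu : RR) (v : 'cV[RR]_n), v != 0 -> M *m v = nu *: v -> nu <= mu.

Definition mutually_independent d (T : measurableType d) (P : probability T RR)
    (m : nat) (X : 'I_m -> {RV P >-> RR}) : Prop :=
  forall B : 'I_m -> set RR, (forall i, measurable (B i)) ->
    P (\bigcap_i (X i @^-1` B i)) = (\prod_(i < m) P (X i @^-1` B i))%E.

(* Main.v *)
(* On the event max |g_j| <= sqrt (12 log n), either form of Assumption 1 gives
   by the power mean inequality
     (sum_j g_j^2 / (lambda_1 - lambda_{j+1})) * max_j 1 / (lambda_1 - lambda_{j+1}) <= 1.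
   The eigenvalue equation reads u_j = g_j u_0 / (mu - lambda_{j+1}) and
   mu - lambda_1 = sum_j g_j^2 / (mu - lambda_{j+1}), where mu >= lambda_1.
   Hence mu - lambda_{j+1} <= 2 (lambda_1 - lambda_{j+1}), and the mass of u
   outside e_1 is at most u_0^2, so |u_0| >= 1/2; this gives the factor 1/4.
   Gaussian tails and independence bound max |g_j| from both sides. *)
Require Import Defs.
From HB Require Import structures.
From mathcomp Require Import all_boot all_order all_algebra.
From mathcomp Require Import all_classical all_reals all_analysis.
From mathcomp Require Import Rstruct Rstruct_topology.
From mathcomp Require Import measurable_realfun.
From mathcomp Require Import ring lra.
Set Implicit Arguments. Unset Strict Implicit. Unset Printing Implicit Defensive.
Import Order.TTheory GRing.Theory Num.Theory.
Import numFieldNormedType.Exports.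
Local Open Scope classical_set_scope.
Local Open Scope ring_scope.

(** * Secular equation and leading eigenvector of the perturbed diagonal matrix *)

(** Intermediate value theorem on [[a, a + S]], where [S] is the right-hand side at [x = a]: all
    poles lie left of [a], and each summand decreases in [x], so the difference of the two sides
    changes sign. *)
Lemma secular_root (R : realType) (m : nat) (a : R) (b g : 'I_m -> R) :
  (forall k, b k < a) ->
  exists2 x, a <= x & x - a = \sum_k g k ^+ 2 / (x - b k).
Proof.
move=> ba.
pose S := \sum_k g k ^+ 2 / (a - b k).
pose f (x : R) : R := x - a - \sum_k g k ^+ 2 / (x - b k).
have S0 : 0 <= S.
  by apply: sumr_ge0 => k _; rewrite divr_ge0 ?sqr_ge0// subr_ge0 ltW.
have aS : a <= a + S by rewrite lerDl.
have fa : f a <= 0 by rewrite /f subrr sub0r oppr_le0.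
have fS : 0 <= f (a + S).
  rewrite /f (addrAC a) subrr add0r subr_ge0; apply: ler_sum => k _.
  rewrite ler_wpM2l ?sqr_ge0// lef_pV2 ?posrE ?subr_gt0 ?ba//.
    by rewrite lerB.
  exact: lt_le_trans (ba k) aS.
have cf : {within `[a, a + S], continuous f}.
  apply/continuous_in_subspaceT => x; rewrite inE/= in_itv/= => /andP[ax _].
  apply: cvgB; first by apply: cvgB; [exact: cvg_id|exact: cvg_cst].
  apply: cvg_big => [|k _]; first exact: add_continuous.
  apply: cvgM; first exact: cvg_cst.
  apply: cvgV; first by rewrite subr_eq0 gt_eqF// (lt_le_trans (ba k)).
  by apply: cvgB; [exact: cvg_id|exact: cvg_cst].
have fle := le_trans fa fS.
have [|x] := @IVT R f a (a + S) 0 aS cf.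
  by rewrite (min_idPl fle) (max_idPr fle) fa fS.
rewrite in_itv/= => /andP[ax _] fx0; exists x => //.
by apply/eqP; rewrite -subr_eq0 -/(f x) fx0.
Qed.

Lemma gext_ord (m : nat) (g : 'I_m -> RR) (k : 'I_m) : gext g k = g k.
Proof. by rewrite /gext valK. Qed.

(** Each row below the first involves only [u_0] and its own entry. One direction analyses a given
    eigenvector, the other certifies the one built from the secular root. *)
Lemma Atilde_eigenP (m : nat) (lam : nat -> RR) (g : 'I_m -> RR) (mu : RR)
    (u : 'cV[RR]_m.+1) :
  @Atilde m.+1 lam g *m u = mu *: u <->
  \sum_k g k * u (lift ord0 k) 0 = (mu - lam 0%N) * u ord0 0 /\
  forall k, g k * u ord0 0 = (mu - lam k.+1) * u (lift ord0 k) 0.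
Proof.
have E0 : (@Atilde m.+1 lam g *m u) ord0 0 =
    lam 0%N * u ord0 0 + \sum_k g k * u (lift ord0 k) 0.
  rewrite mxE big_ord_recl !mxE eqxx/= addr0; congr (_ + _).
  apply: eq_bigr => k _; rewrite !mxE (negbTE (neq_lift _ _)) lift0 /= add0r.
  by rewrite gext_ord.
have E1 k : (@Atilde m.+1 lam g *m u) (lift ord0 k) 0 =
    g k * u ord0 0 + lam k.+1 * u (lift ord0 k) 0.
  rewrite mxE big_ord_recl; congr (_ + _).
    by rewrite !mxE eq_sym (negbTE (neq_lift _ _)) lift0 /= add0r gext_ord.
  rewrite (bigD1 k)//= big1 ?addr0; last first.
    move=> j jk; rewrite !mxE (inj_eq (@lift_inj _ ord0)) eq_sym (negbTE jk).
    by rewrite !lift0 /= addr0 mul0r.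
  by rewrite !mxE eqxx lift0 /= addr0.
split=> [e|[e0 e1]].
  split=> [|k]; [move/matrixP : e => /(_ ord0 0)|
                 move/matrixP : e => /(_ (lift ord0 k) 0)].
    by rewrite E0 [RHS]mxE => /esym e; rewrite mulrBl e addrC addKr.
  by rewrite E1 [RHS]mxE => /esym e; rewrite mulrBl e addrK.
apply/matrixP => i j; rewrite (ord1 j).
have [k ->|->] := unliftP ord0 i; rewrite [RHS]mxE.
  by rewrite E1 e1 -mulrDl subrK.
by rewrite E0 e0 -mulrDl addrC subrK.
Qed.

(* The secular root gives an eigenvalue at least [lam 0], so no variational
   characterization of the leading eigenvalue is needed. *)
Lemma leading_eigenvalue_ge (m : nat) (lam : nat -> RR) (g : 'I_m -> RR)
    (mu : RR) :
  (forall k : 'I_m, lam k.+1 < lam 0%N) ->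
  (forall (nu : RR) (v : 'cV[RR]_m.+1),
     v != 0 -> @Atilde m.+1 lam g *m v = nu *: v -> nu <= mu) ->
  lam 0%N <= mu.
Proof.
move=> lam_lt mu_max.
have [x lamx ex] := @secular_root _ _ _ _ g lam_lt.
apply: (le_trans lamx).
(* With first entry 1 the lower rows force the other entries; the first row is then the secular
   equation at [x]. *)
pose v : 'cV[RR]_m.+1 :=
  \col_i (if unlift ord0 i is Some k then g k / (x - lam k.+1) else 1).
have v0 : v ord0 0 = 1 by rewrite mxE unlift_none.
have vk k : v (lift ord0 k) 0 = g k / (x - lam k.+1) by rewrite mxE liftK.
apply: (mu_max x v).
  by apply/eqP => /matrixP/(_ ord0 0)/eqP; rewrite v0 mxE oner_eq0.
apply/Atilde_eigenP; rewrite v0 mulr1 ex; split=> [|k].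
  by apply: eq_bigr => k _; rewrite vk mulrA expr2.
rewrite vk mulr1 mulrC divfK// subr_eq0 gt_eqF//.
exact: lt_le_trans (lam_lt k) lamx.
Qed.

(** Deterministic core. [D] is left free, instead of being the largest inverse gap, so that
    whichever norm Assumption 1 controls can serve. *)
Lemma leading_eigenvector_entry_ge (m : nat) (lam : nat -> RR)
    (g : 'I_m -> RR) (D : RR) (u : 'cV[RR]_m.+1) :
  (forall k : 'I_m, lam k.+1 < lam 0%N) ->
  (forall k : 'I_m, (lam 0%N - lam k.+1)^-1 <= D) ->
  (\sum_k g k ^+ 2 / (lam 0%N - lam k.+1)) * D <= 1 ->
  unit_leading_eigenvector (@Atilde m.+1 lam g) u ->
  forall k, `|g k| / (4 * (lam 0%N - lam k.+1)) <= `|u (lift ord0 k) 0|.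
Proof.
move=> lam_lt dD SD [u1 [mu [/Atilde_eigenP[e0 ek] mu_max]]] k.
have lam_mu := leading_eigenvalue_ge lam_lt mu_max.
set S := \sum_k _ in SD.
have gap (k' : 'I_m) : 0 < lam 0%N - lam k'.+1 by rewrite subr_gt0.
have gap_mu (k' : 'I_m) : lam 0%N - lam k'.+1 <= mu - lam k'.+1 by rewrite lerD2r.
have mu_gap (k' : 'I_m) : 0 < mu - lam k'.+1 := lt_le_trans (gap k') (gap_mu k').
have inv_le (k' : 'I_m) : (mu - lam k'.+1)^-1 <= (lam 0%N - lam k'.+1)^-1.
  by rewrite lef_pV2 ?posrE ?mu_gap ?gap ?gap_mu.
have uk k' : u (lift ord0 k') 0 = g k' * u ord0 0 / (mu - lam k'.+1).
  by rewrite ek mulrC mulKf// gt_eqF.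
have un0 : u ord0 0 != 0.
  apply/eqP => u0; move: u1; rewrite big_ord_recl big1.
    by rewrite u0 expr0n addr0 => /eqP; rewrite eq_sym oner_eq0.
  by move=> k' _; rewrite uk u0 mulr0 mul0r expr0n.
(* Dividing the first row by [u_0] gives the secular equation for [mu]; lowering [mu] to [lam 0] in
   the denominators only increases the sum. *)
have muS : mu - lam 0%N <= S.
  have -> : mu - lam 0%N = \sum_k g k ^+ 2 / (mu - lam k.+1).
    apply: (mulIf un0); rewrite -e0 mulr_suml; apply: eq_bigr => k' _.
    by rewrite uk; ring.
  apply: ler_sum => k' _; by rewrite ler_wpM2l ?sqr_ge0.
have D0 : 0 <= D by apply: le_trans (dD k); rewrite invr_ge0 ltW.
(* Of the two factors [1 / (mu - lam k.+1)], one is compared with the inverse gap, which yields [S],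
   and the other with [D]. *)
have tail : \sum_k (g k / (mu - lam k.+1)) ^+ 2 <= 1.
  apply: le_trans SD; rewrite /S mulr_suml; apply: ler_sum => k' _.
  rewrite expr_div_n -mulrA ler_wpM2l ?sqr_ge0// expr2 invfM.
  have h := ltW (mu_gap k').
  apply: ler_pM; rewrite ?invr_ge0//; first exact: inv_le.
  exact: le_trans (inv_le k') (dD k').
(* The unit norm reads [u_0^2 (1 + T) = 1] with [T <= 1], so [u_0^2 >= 1/2 >= 1/4]. *)
have u0ge : 2^-1 <= `|u ord0 0|.
  rewrite -(@ler_pXn2r _ 2)// ?nnegrE ?invr_ge0// real_normK ?num_real//.
  have : u ord0 0 ^+ 2 * (1 + \sum_k (g k / (mu - lam k.+1)) ^+ 2) = 1.
    rewrite -[RHS]u1 big_ord_recl mulrDr mulr1; congr (_ + _).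
    by rewrite mulr_sumr; apply: eq_bigr => k' _; rewrite uk; ring.
  set T := \sum_k _ in tail *.
  have := sqr_ge0 (u ord0 0); set w := u ord0 0 ^+ 2 => w0 wT.
  have : w * (1 + T) <= w * 2 by rewrite ler_wpM2l//; lra.
  rewrite wT; lra.
have ratio : (mu - lam k.+1) <= 2 * (lam 0%N - lam k.+1).
  have {}SD : (mu - lam 0%N) / (lam 0%N - lam k.+1) <= 1.
    apply: le_trans SD; apply: ler_pM => //; first by rewrite subr_ge0.
    by rewrite invr_ge0 ltW.
  by move: SD; rewrite (ler_pdivrMr _ _ (gap k)) mul1r; lra.
rewrite uk normrM normrM normfV (gtr0_norm (mu_gap k)) -mulrA ler_wpM2l//.
rewrite (ler_pdivlMr _ _ (mu_gap k)) mulrC ler_pdivrMr ?mulr_gt0 ?gap//.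
apply: (le_trans ratio).
have := ler_wpM2r (ltW (gap k)) u0ge; lra.
Qed.

(** * Norm inequalities and the consequence of Assumption 1 *)

(** Young's inequality applied to each product of [c * a i] with 1. [N] may exceed the length
    because the sums over [1 <= j < n] have [n - 1] terms while Assumption 1 uses [n]. *)
Lemma power_mean (R : realType) (I : eqType) (r : seq I) (a : I -> R) (q N : R) :
  1 < q -> 0 < N -> (size r)%:R <= N -> (forall i, 0 <= a i) ->
  \sum_(i <- r) a i <= N `^ (1 - q^-1) * (\sum_(i <- r) a i `^ q) `^ q^-1.
Proof.
move=> q1 N0 rN a0; have q0 : 0 < q := lt_trans ltr01 q1.
set Q := \sum_(i <- r) a i `^ q.
have Q0 : 0 <= Q by apply: sumr_ge0 => i _; exact: powR_ge0.
have [QE|Qn0] := eqVneq Q 0.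
  rewrite big_seq big1 ?mulr_ge0 ?powR_ge0// => i ir.
  apply/(@powR_eq0_eq0 _ _ q)/eqP.
  have /eqP := QE; rewrite psumr_eq0; last by move=> j _; exact: powR_ge0.
  by move=> /allP/(_ i ir).
have {Q0 Qn0}Q0 : 0 < Q by rewrite lt_neqAle eq_sym Qn0.
have A0 : 0 < Q `^ q^-1 by rewrite powR_gt0.
have qV1 : q^-1 < 1 by rewrite invf_lt1.
have s0 : 0 < 1 - q^-1 by rewrite subr_gt0.
(* This scaling makes the sum of [(c * a i)^q] equal to [N], so the Young bounds add up to at most
   [N / q + N (1 - 1/q) = N]. *)
pose c := N `^ q^-1 / Q `^ q^-1.
have c0 : 0 < c by rewrite divr_gt0 ?powR_gt0.
have cq : c `^ q = N / Q.
  rewrite /c powRM ?invr_ge0 ?powR_ge0// -powRN -!powRrM mulNr mulVf ?gt_eqF//.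
  by rewrite powRr1 ?ltW// powR_inv1 ?ltW.
have young i : c * a i <= N / Q * a i `^ q / q + (1 - q^-1).
  have := @conjugate_powR _ (c * a i) 1 q (1 - q^-1)^-1.
  rewrite mulr1 powR1 mul1r !invrK powRM ?(ltW c0)// cq; apply => //.
  - by rewrite mulr_ge0// ltW.
  - by rewrite invr_gt0.
  - by rewrite addrC subrK.
have csum : c * \sum_(i <- r) a i <= N.
  apply: (@le_trans _ _ (\sum_(i <- r) (N / Q * a i `^ q / q + (1 - q^-1)))).
    by rewrite mulr_sumr; apply: ler_sum => i _.
  rewrite big_split/= big_const_seq count_predT iter_addr_0.
  rewrite -mulr_suml -mulr_sumr -/Q divfK ?gt_eqF//.
  rewrite -[leRHS](mulr1 N) -[X in _ <= N * X](subrK q^-1) (addrC _ q^-1) mulrDr.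
  by rewrite lerD2l -mulr_natr mulrC ler_wpM2r// ltW.
have NE : N `^ (1 - q^-1) = N / N `^ q^-1.
  by rewrite powRB ?powRr1 ?ltW// gt_eqF// implybT.
rewrite NE.
have -> : N / N `^ q^-1 * Q `^ q^-1 = N / c by rewrite /c invf_div mulrA mulrAC.
by rewrite ler_pdivlMr// mulrC.
Qed.

(** Inverting [exp(-1/2) >= 1 - 1/2] gives [exp(1/2) <= 2]. This keeps [log n] away from 0 for
    [n >= 2]. *)
Lemma ln2_ge (R : realType) : 2^-1 <= ln 2 :> R.
Proof.
have h : expR (- 2^-1) >= 2^-1 :> R.
  by apply: le_trans (expR_ge1Dx _); lra.
rewrite -ler_expR lnK ?posrE//.
by rewrite -[leLHS]invrK -expRN -[leRHS]invrK lef_pV2 ?posrE ?expR_gt0 ?invr_gt0.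
Qed.

(** Here [l] is [log n] and [x] is the 1-norm of [d], which also serves as [D]. *)
Lemma l1_gap_bound (R : realFieldType) (l x c : R) :
  0 <= x -> 2^-1 <= l -> l * x <= c -> l * x * x <= 2 * c ^+ 2.
Proof.
move=> x0 l2 lxc; have x2c : x <= 2 * c by have := ler_wpM2r x0 l2; lra.
have lx0 : 0 <= l * x by rewrite mulr_ge0// (le_trans _ l2)// invr_ge0.
by apply: le_trans (ler_pM lx0 x0 lxc x2c) _; rewrite expr2; lra.
Qed.

(** Here [l] is [log n], [x] the 1-norm of [d], [N = n^(1/p)] and [D] the [p/(p-2)]-norm; the last
    hypothesis is Assumption 1 squared. The bound [2 c^2] is the one shared with the 1-norm case. *)
Lemma lp_gap_bound (R : realFieldType) (l x c p N D : R) :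
  2 <= p -> 0 <= l -> 0 <= D -> x <= N ^+ 2 * D ->
  p * l * N ^+ 2 * D ^+ 2 <= c ^+ 2 -> l * x * D <= 2 * c ^+ 2.
Proof.
move=> p2 l0 D0 xD bound.
have h : l * x * D <= l * N ^+ 2 * D ^+ 2.
  have -> : l * N ^+ 2 * D ^+ 2 = l * (N ^+ 2 * D) * D by ring.
  by rewrite ler_wpM2r// ler_wpM2l.
apply: (le_trans h).
have : 0 <= l * N ^+ 2 * D ^+ 2 by rewrite -mulrA mulr_ge0// mulr_ge0// sqr_ge0.
have : p * l * N ^+ 2 * D ^+ 2 = p * (l * N ^+ 2 * D ^+ 2) by ring.
move: bound; move: (p * l * _ * _) (l * _ * _) => Z Y Zc ZY Y0.
have : 2 * Y <= p * Y by rewrite ler_wpM2r.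
by have := sqr_ge0 c; lra.
Qed.

(** [D] is the norm appearing in the alternative that holds; it dominates every entry. For
    [q = p/(p-2)] the power mean factor [n^(1 - 1/q)] is [n^(2/p)], the square of the factor in
    Assumption 1. *)
Lemma Assumption1_gap_bound (c0 : RR) (n : nat) (lam : nat -> RR) :
  0 <= c0 -> (2 <= n)%N -> Assumption1 c0 n lam ->
  exists D : RR, (forall j, (1 <= j < n)%N -> `|dvec lam j| <= D) /\
    ln n%:R * dnorm_1 n lam * D <= 2 * c0 ^+ 2.
Proof.
move=> c00 n2 A1.
have n0 : 0 < n%:R :> RR by rewrite ltr0n (leq_trans _ n2).
have lnn : 2^-1 <= ln n%:R :> RR.
  by apply: (le_trans (ln2_ge _)); rewrite ler_ln ?posrE// ler_nat.
have ln0 : 0 < ln n%:R :> RR by apply: lt_le_trans lnn; rewrite invr_gt0.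
have sizen : (size (index_iota 1 n))%:R <= n%:R :> RR.
  by rewrite size_iota ler_nat leq_subr.
have d1_ge0 : 0 <= dnorm_1 n lam by apply: sumr_ge0.
case: A1 => [[p [p2 bound]]|bound]; last first.
  exists (dnorm_1 n lam); split=> [j jn|].
    rewrite /dnorm_1 (bigD1_seq j) ?iota_uniq ?mem_index_iota//= lerDl.
    exact: sumr_ge0.
  exact: l1_gap_bound.
exists (dnorm_p n lam p).
have p0 : 0 < p by apply: lt_le_trans p2.
pose N := n%:R `^ p^-1 : RR.
have N0 : 0 < N by rewrite powR_gt0.
have NN : N ^+ 2 = n%:R `^ (2 / p).
  by rewrite mulrC powRrM powR_mulrn// ltW.
have [D0 dD d1D] : [/\ 0 <= dnorm_p n lam p,
    forall j, (1 <= j < n)%N -> `|dvec lam j| <= dnorm_p n lam p &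
    dnorm_1 n lam <= N ^+ 2 * dnorm_p n lam p].
  (* At [p = 2] the norm is the maximum and the factor is [n], so counting terms suffices. *)
  rewrite NN /dnorm_p; have [->|pn2] := eqVneq p 2.
    have dD j : (1 <= j < n)%N -> `|dvec lam j| <= dnorm_inf n lam.
      move=> jn; rewrite /dnorm_inf.
      by apply: (@le_bigmax_seq _ RR _ _ 0 j xpredT (fun j => `|dvec lam j|));
        rewrite ?mem_index_iota.
    have D0 : 0 <= dnorm_inf n lam by exact: le_trans (dD 1%N _).
    split=> //; rewrite divff// (powRr1 (ltW n0)) /dnorm_1 big_seq.
    apply: (@le_trans _ _ (\sum_(j <- index_iota 1 n) dnorm_inf n lam)).
      rewrite [leRHS]big_seq; apply: ler_sum => j.
      by rewrite mem_index_iota; exact: dD.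
    by rewrite big_const_seq count_predT iter_addr_0 -[leLHS]mulr_natl ler_wpM2r.
  have pgt2 : 0 < p - 2 by rewrite subr_gt0 lt_neqAle eq_sym pn2.
  set q := p / (p - 2).
  have qV : q^-1 = 1 - 2 / p.
    by rewrite /q invf_div mulrBl divff ?gt_eqF.
  have q0 : 0 < q by rewrite divr_gt0.
  have q1 : 1 < q by rewrite ltr_pdivlMr// mul1r; lra.
  split=> [|j jn|]; first exact: powR_ge0.
    have <- : (`|dvec lam j| `^ q) `^ q^-1 = `|dvec lam j|.
      by rewrite -powRrM divff ?gt_eqF// powRr1.
    rewrite /dnorm_q; apply: ge0_ler_powR; rewrite ?nnegrE ?powR_ge0//.
    - by rewrite invr_ge0 ltW.
    - by apply: sumr_ge0 => *; exact: powR_ge0.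
    rewrite (bigD1_seq j) ?iota_uniq ?mem_index_iota//= lerDl.
    by apply: sumr_ge0 => *; exact: powR_ge0.
  have -> : 2 / p = 1 - q^-1 by rewrite qV; lra.
  exact: power_mean.
split=> //; set D := dnorm_p n lam p in bound D0 d1D *.
have {}bound : (p * ln n%:R) * N ^+ 2 * D ^+ 2 <= c0 ^+ 2.
  rewrite -[p * _]sqr_sqrtr ?mulr_ge0 ?(ltW ln0) ?(ltW p0)// -!exprMn.
  by rewrite ler_sqr ?nnegrE// ?mulr_ge0 ?sqrtr_ge0 ?(ltW N0).
exact: (lp_gap_bound p2 (ltW ln0) D0 d1D bound).
Qed.

(** * Upper and lower tail bounds for one Gaussian variable *)

Section normal_bounds.
Context {R : realType}.
Notation mu := (@lebesgue_measure R).
Notation gauss := (normal_prob (0 : R) 1).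

Let measurable_pdf (s : R) (B : set R) :
  measurable_fun B (EFin \o normal_pdf 0 s).
Proof.
by apply/measurable_EFinP; apply: measurable_funTS; exact: measurable_normal_pdf.
Qed.

(* Comparison with the density of variance 2 gives the tail bound without
   computing any Gaussian integral. *)
Lemma normal_prob_itvcc_ge : exists2 K : R, 0 < K &
  forall s : R, 0 <= s ->
    ((1 - K * expR (- (s ^+ 2 / 4)))%:E <= gauss (`[- s, s]%classic : set R)%R)%E.
Proof.
have s2 : Num.sqrt 2 != 0 :> R by rewrite sqrtr_eq0 -ltNge.
(* For [|x| > s], [exp(-x^2/2) <= exp(-s^2/4) exp(-x^2/4)]; the ratio of peaks turns the last factor
   into the density of variance 2. *)
exists (normal_peak 1 / normal_peak (Num.sqrt 2)) => [|s s0].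
  by rewrite divr_gt0// normal_peak_gt0// oner_neq0.
set K := _ / _; set e := K * _.
have K0 : 0 < K by rewrite divr_gt0// normal_peak_gt0// oner_neq0.
have e0 : 0 <= e by rewrite mulr_ge0 ?expR_ge0 ?ltW.
have mB : measurable (`[- s, s]%classic : set R) by [].
have mA : measurable (~` `[- s, s]%classic : set R) by exact: measurableC.
suff : (gauss (~` `[- s, s]%classic)%R <= e%:E)%E.
  rewrite probability_setC// EFinB => h.
  by rewrite leeBlDr// addeC -leeBlDr// ?fin_num_measure.
rewrite /normal_prob.
apply: (@le_trans _ _ (\int[mu]_(x in (~` `[- s, s]%classic)%R)
    (e%:E * (normal_pdf 0 (Num.sqrt 2) x)%:E)))%E.
  apply: ge0_le_integral => //.
  - by move=> x _; rewrite lee_fin normal_pdf_ge0.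
  - exact: measurable_pdf.
  - by apply: measurable_funeM; exact: measurable_pdf.
  move=> x /= /negP; rewrite in_itv/= -ler_norml -ltNge => sx.
  rewrite -EFinM lee_fin !normal_pdfE ?oner_neq0// /normal_fun !subr0.
  rewrite expr1n sqr_sqrtr// /e /K.
  have xs : s ^+ 2 <= x ^+ 2.
    by rewrite -[leRHS]real_normK ?num_real// lerXn2r ?nnegrE ?normr_ge0// ltW.
  rewrite [leRHS](_ : _ = normal_peak 1 *
      (expR (- (s ^+ 2 / 4)) * expR (- x ^+ 2 / (2 *+ 2)))); last first.
    by field; rewrite gt_eqF// normal_peak_gt0.
  rewrite ler_wpM2l ?normal_peak_ge0// -exp.expRD ler_expR; lra.
have -> : (\int[mu]_(x in (~` `[- s, s]%classic)%R)
      (e%:E * (normal_pdf 0 (Num.sqrt 2) x)%:E) =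
    e%:E * normal_prob 0%R (Num.sqrt 2) (~` `[- s, s]%classic)%R)%E.
  apply: ge0_integralZl_EFin => //; last exact: measurable_pdf.
  by move=> x _; rewrite lee_fin normal_pdf_ge0.
rewrite -[leRHS]mule1 lee_wpmul2l ?lee_fin//.
exact: (@probability_le1 _ _ _ (normal_prob 0 (Num.sqrt 2))).
Qed.

(** The unit interval [[t, t + 1]] avoids []-t, t[], and its density is at least the peak times
    [exp(-(t+1)^2/2)]. Since [(t+1)^2/2 <= t^2 + 1], the constant is the peak times [exp(-1)]. *)
Lemma normal_prob_itvoo_le : exists2 k : R, 0 < k &
  forall t : R, 0 <= t ->
    (gauss (`]- t, t[%classic : set R)%R <= (1 - k * expR (- t ^+ 2))%:E)%E.
Proof.
have p0 : 0 < normal_peak 1 :> R by rewrite normal_peak_gt0// oner_neq0.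
exists (normal_peak 1 * expR (- 1)) => [|t t0]; first by rewrite mulr_gt0 ?expR_gt0.
set e := _ * expR (- t ^+ 2).
have mB : measurable (`]- t, t[%classic : set R) by [].
suff h : (e%:E <= gauss `[t, (t + 1)%R]%classic)%E.
  have : (e%:E <= gauss (~` `]- t, t[%classic)%R)%E.
    apply: (le_trans h); apply: le_measure; rewrite ?inE//.
      exact: measurableC.
    by move=> x /=; rewrite !in_itv/= => /andP[tx _] /andP[_]; rewrite ltNge tx.
  rewrite probability_setC// EFinB => {}h.
  by rewrite leeBrDr// addeC -leeBrDr// ?fin_num_measure.
have -> : e%:E = (\int[mu]_(x in `[t, (t + 1)%R]) cst e%:E x)%E.
  rewrite integral_cst//= lebesgue_measure_itv/= lte_fin ltrDl ltr01.
  by rewrite -EFinD addrAC subrr add0r mule1.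
apply: ge0_le_integral => //=.
- by move=> x _; rewrite lee_fin /e !mulr_ge0 ?expR_ge0 ?ltW.
- exact: measurable_pdf.
move=> x; rewrite in_itv/= => /andP[tx xt].
rewrite lee_fin normal_pdfE ?oner_neq0// /normal_fun subr0 expr1n /e -mulrA.
rewrite ler_wpM2l ?normal_peak_ge0// -exp.expRD ler_expR.
have : x ^+ 2 <= (t + 1) ^+ 2 by rewrite lerXn2r ?nnegrE//; lra.
have := sqr_ge0 (t - 1); rewrite !expr2; lra.
Qed.

End normal_bounds.

(** * Passing from one variable to [n - 1]: bounds of order [n^-2] *)

(** Bernoulli's inequality; under independence it replaces a union bound. *)
Lemma one_sub_expr_ge (R : realFieldType) (x e : R) (m : nat) :
  0 <= x <= 1 -> 1 - e <= x -> 1 - m%:R * e <= x ^+ m.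
Proof.
move=> /andP[x0 x1] xe.
have bernoulli : 1 - m%:R * (1 - x) <= x ^+ m.
  elim: m => [|m IH]; first by rewrite mul0r subr0.
  have := ler_wpM2l x0 IH; have := mulr_ge0 (ler0n R m) (sqr_ge0 (1 - x)).
  by rewrite (exprS x m) -natr1; move: (x ^+ m) (m%:R) => y k; nra.
apply: le_trans bernoulli; rewrite lerD2l lerN2 ler_wpM2l//; lra.
Qed.

Lemma exprn_le_expRN (R : realType) (x e : R) (m : nat) :
  0 <= x -> x <= 1 - e -> x ^+ m <= expR (- (m%:R * e)).
Proof.
move=> x0 xe; rewrite -mulrN mulrC expRM_natr lerXn2r ?nnegrE ?expR_ge0//.
exact: le_trans xe (expR_ge1Dx _).
Qed.

Lemma expR_ln_mul (R : realType) (n k : nat) :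
  (0 < n)%N -> expR (k%:R * ln n%:R) = n%:R ^+ k :> R.
Proof. by move=> n0; rewrite mulrC expRM_natr lnK// posrE ltr0n. Qed.

(** At the level [s^2 = 12 log n] a single tail is of order [n^-3], and the [n - 1] coordinates cost
    one power of [n]. *)
Lemma small_tail_le (R : realType) (K : R) (n : nat) :
  0 < K -> (0 < n)%N ->
  n.-1%:R * (K * expR (- (12 * ln n%:R / 4))) <= K / n%:R ^+ 2.
Proof.
move=> K0 n0.
have n0R : 0 < n%:R :> R by rewrite ltr0n.
have -> : 12 * ln n%:R / 4 = 3%:R * ln n%:R :> R by lra.
rewrite expRN expR_ln_mul// mulrCA ler_wpM2l ?(ltW K0)//.
rewrite exprSr invfM mulrCA ger_pMr ?invr_gt0 ?exprn_gt0//.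
by rewrite ler_pdivrMr// mul1r ler_nat leq_pred.
Qed.

(* [expR y >= y ^+ 4 / 24], applied to [y = k * sqrt n / 2]. *)
Lemma large_max_le (R : realType) (k : R) (n : nat) :
  0 < k -> (2 <= n)%N ->
  expR (- (n.-1%:R * (k * expR (- (ln n%:R / 4))))) <=
    (384 / k ^+ 4) / n%:R ^+ 2.
Proof.
move=> k0 n2.
have n0 : 0 < n%:R :> R by rewrite ltr0n (leq_trans _ n2).
have n1 : 2 <= n%:R :> R by rewrite ler_nat.
pose L : R := ln n%:R.
have L0 : 0 <= L by rewrite ln_ge0//; lra.
have nL : expR L = n%:R by rewrite lnK.
pose y := k / 2 * expR (L / 2).
have y0 : 0 < y by rewrite mulr_gt0 ?expR_gt0 ?divr_gt0.
(* Uses [n - 1 >= n/2] and [n^(3/4) >= n^(1/2)]. *)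
have y_le : y <= n.-1%:R * (k * expR (- (L / 4))).
  have nE : n%:R / 2 <= n.-1%:R :> R.
    have -> : n.-1%:R = n%:R - 1 :> R by rewrite -subn1 natrB// ltnW.
    lra.
  have h : expR (L / 2) <= n%:R * expR (- (L / 4)).
    by rewrite -nL -exp.expRD ler_expR; lra.
  have ke : 0 <= k * expR (- (L / 4)) by rewrite mulr_ge0 ?expR_ge0 ?ltW.
  apply: le_trans (ler_wpM2r ke nE).
  have -> : n%:R / 2 * (k * expR (- (L / 4))) =
    k / 2 * (n%:R * expR (- (L / 4))) by ring.
  by rewrite ler_wpM2l// divr_ge0// (ltW k0).
have y4 : y ^+ 4 = k ^+ 4 * n%:R ^+ 2 / 16.
  have -> : n%:R ^+ 2 = expR (L / 2) ^+ 4.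
    by rewrite -nL -!expRM_natr; congr expR; lra.
  by rewrite /y; field.
have ey : y ^+ 4 / 24 <= expR y.
  have := @expR_ge1Dxn R y 3 (ltW y0); rewrite (_ : (4`! = 24)%N)//; lra.
rewrite -/L; apply: (@le_trans _ _ (expR (- y))).
  by rewrite ler_expR lerN2.
(* The constant 384 is [24 * 16], from the factorial and from [(k/2)^4]. *)
rewrite expRN (_ : 384 / k ^+ 4 / n%:R ^+ 2 = (y ^+ 4 / 24)^-1).
  by rewrite lef_pV2 ?posrE ?expR_gt0// divr_gt0// exprn_gt0.
by rewrite y4; field; rewrite !gt_eqF.
Qed.

(** * Events for the whole Gaussian vector *)

Lemma iid_normal_all (d : measure_display) (T : measurableType d)
    (P : probability T RR) (m : nat) (g : 'I_m -> {RV P >-> RR}) (B : set RR) :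
  mutually_independent g ->
  (forall (j : 'I_m) (B : set RR), measurable B ->
     distribution P (g j) B = normal_prob 0 1 B) ->
  measurable B ->
  P (\bigcap_i (g i @^-1` B)) = (fine (normal_prob (0 : RR) 1 B) ^+ m)%:E.
Proof.
move=> indep gauss mB; rewrite indep//.
have fB : normal_prob (0 : RR) 1 B = (fine (normal_prob (0 : RR) 1 B))%:E.
  by rewrite fineK// fin_num_measure.
under eq_bigr => i _.
  rewrite (_ : P (g i @^-1` B) = distribution P (g i) B)// gauss// fB.
  over.
by rewrite prodEFin prodr_const card_ord.
Qed.

Lemma bigcap_preimage_measurable (d : measure_display) (T : measurableType d)
    (P : probability T RR) (m : nat) (g : 'I_m -> {RV P >-> RR}) (B : set RR) :
  measurable B -> measurable (\bigcap_i (g i @^-1` B)).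
Proof.
move=> mB; apply: fin_bigcap_measurable; first exact: finite_finset.
by move=> i _; rewrite -[X in measurable X]setTI; exact: measurable_funP.
Qed.

(** Subadditivity, since [A] is covered by [A \ B] and [B]. *)
Lemma probability_setD_ge (R : realType) (d : measure_display)
    (T : measurableType d) (P : probability T R) (A B : set T) (a b : R) :
  measurable A -> measurable B ->
  ((1 - a)%:E <= P A)%E -> (P B <= b%:E)%E ->
  ((1 - (a + b))%:E <= P (A `\` B))%E.
Proof.
move=> mA mB PA PB.
have fin X : measurable X -> P X = (fine (P X))%:E.
  by move=> mX; rewrite fineK// fin_num_measure.
have mAB := measurableD mA mB.
have : (P A <= P (A `\` B) + P B)%E.
  apply: le_trans (measureU2 P mAB mB); apply: le_measure; rewrite ?inE//.
    exact: measurableU.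
  by move=> x Ax; have [Bx|nBx] := pselect (B x); [right|left].
move: PA PB; rewrite (fin A)// (fin B)// (fin _ mAB) -EFinD !lee_fin; lra.
Qed.

(** * Entry bounds under Assumption 1 and the conclusion *)

Lemma Assumption1_entry_ge (m : nat) (lam : nat -> RR) (g : 'I_m -> RR)
    (u : 'cV[RR]_m.+1) :
  (0 < m)%N -> (forall k : 'I_m, lam k.+1 < lam 0%N) ->
  Assumption1 5^-1 m.+1 lam -> (forall k, g k ^+ 2 <= 12 * ln m.+1%:R) ->
  unit_leading_eigenvector (@Atilde m.+1 lam g) u ->
  forall k, `|g k| / (4 * (lam 0%N - lam k.+1)) <= `|u (lift ord0 k) 0|.
Proof.
move=> m0 lam_lt A1 g_le; have c0_ge0 : 0 <= 5^-1 :> RR by rewrite invr_ge0.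
have [D [dD bound]] := Assumption1_gap_bound c0_ge0 (m0 : (2 <= m.+1)%N) A1.
have dvecE (k : 'I_m) : `|dvec lam k.+1| = (lam 0%N - lam k.+1)^-1.
  by rewrite /dvec gtr0_norm// invr_gt0 subr_gt0.
have dD' (k : 'I_m) : (lam 0%N - lam k.+1)^-1 <= D.
  by rewrite -dvecE; apply: dD; exact: (ltn_ord k).
apply: (@leading_eigenvector_entry_ge _ _ _ D) => //.
have D0 : 0 <= D.
  by apply: le_trans (dD' (Ordinal m0)); rewrite invr_ge0 subr_ge0 ltW.
have d1 : dnorm_1 m.+1 lam = \sum_(k < m) (lam 0%N - lam k.+1)^-1.
  rewrite /dnorm_1 big_add1 big_mkord; apply: eq_bigr => k _; exact: dvecE.
have S_le : \sum_k g k ^+ 2 / (lam 0%N - lam k.+1) <=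
    12 * ln m.+1%:R * dnorm_1 m.+1 lam.
  rewrite d1 mulr_sumr; apply: ler_sum => k _.
  apply: ler_wpM2r; last exact: g_le.
  by rewrite invr_ge0 subr_ge0 (ltW (lam_lt k)).
apply: (le_trans (ler_wpM2r D0 S_le)).
have -> : 12 * ln m.+1%:R * dnorm_1 m.+1 lam * D =
    12 * (ln m.+1%:R * dnorm_1 m.+1 lam * D) :> RR by rewrite !mulrA.
(* This value is [24/25]; the choice [c0 = 1/5] serves to bring it below 1. *)
apply: (@le_trans _ _ (12 * (2 * 5^-1 ^+ 2))); first exact: ler_wpM2l.
by clear; lra.
Qed.

Theorem theorem2 :
  exists c0 : RR, 0 < c0 /\ exists C : RR, 0 < C /\ exists c : RR, 0 < c /\
  forall (n : nat), (2 <= n)%N ->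
  forall lam : nat -> RR,
    lam 1%N < lam 0%N ->
    (forall j : nat, (1 <= j)%N -> (j.+1 < n)%N -> lam j.+1 <= lam j) ->
    Assumption1 c0 n lam ->
  forall (d : measure_display) (T : measurableType d) (P : probability T RR)
         (g : 'I_n.-1 -> {RV P >-> RR}),
    mutually_independent g ->
    (forall (j : 'I_n.-1) (B : set RR), measurable B ->
       distribution P (g j) B = normal_prob 0 1 B) ->
    (exists S : set T, measurable S /\
       ((1 - C / (n%:R ^+ 2))%:E <= P S)%E /\
       forall w, S w ->
         forall u : 'cV[RR]_n,
           unit_leading_eigenvector (Atilde lam (fun j => g j w)) u ->
           forall i : 'I_n, (0 < i)%N ->
             `|gext (fun j => g j w) i.-1| / (4 * (lam 0%N - lam i)) <= `|u i 0|)
    /\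
    (exists S : set T, measurable S /\
       ((1 - C / (n%:R ^+ 2))%:E <= P S)%E /\
       forall w, S w ->
         forall u : 'cV[RR]_n,
           unit_leading_eigenvector (Atilde lam (fun j => g j w)) u ->
           exists i : 'I_n, (0 < i)%N /\
             c * Num.sqrt (ln n%:R) <= (lam 0%N - lam i) * `|u i 0|).
Proof.
have [K K0 itvcc] := @normal_prob_itvcc_ge RR.
have [k k0 itvoo] := @normal_prob_itvoo_le RR.
have C2 : 0 < 384 / k ^+ 4 by rewrite divr_gt0// exprn_gt0.
exists 5^-1; split; first by rewrite invr_gt0.
exists (K + 384 / k ^+ 4); split; first by rewrite addr_gt0.
(* The value 1/8 combines the factor 1/4 of the entry bound with the threshold
   [t = sqrt(log n) / 2]. *)
exists 8^-1; split; first by rewrite invr_gt0.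
case=> [//|m] m0 lam lam10 lam_anti A1 d T P g indep gauss.
have lam_lt (i : 'I_m) : lam i.+1 < lam 0%N.
  case: i => i; elim: i => [//|i IH] im.
  exact: le_lt_trans (lam_anti i.+1 isT im) (IH (ltnW im)).
pose L : RR := ln m.+1%:R.
have L0 : 0 <= L by rewrite ln_ge0// ler1n.
pose s : RR := Num.sqrt (12 * L).
have s0 : 0 <= s by exact: sqrtr_ge0.
have s2 : s ^+ 2 = 12 * L by rewrite sqr_sqrtr// mulr_ge0.
pose t : RR := Num.sqrt L / 2.
have t0 : 0 <= t by rewrite divr_ge0// sqrtr_ge0.
have t2 : t ^+ 2 = L / 4.
  by rewrite exprMn sqr_sqrtr// exprVn -natrX.
have mI : measurable (`[- s, s]%classic : set RR) by [].
have mJ : measurable (`]- t, t[%classic : set RR) by [].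
(* On [A] the entry bounds hold; outside [B] some [|g_i|] reaches [t]. The first claim uses [A], the
   second [A \ B]. *)
pose A := \bigcap_i (g i @^-1` `[- s, s]%classic).
pose B := \bigcap_i (g i @^-1` `]- t, t[%classic).
have mA : measurable A by exact: bigcap_preimage_measurable.
have mB : measurable B by exact: bigcap_preimage_measurable.
have PA : ((1 - K / m.+1%:R ^+ 2)%:E <= P A)%E.
  rewrite (iid_normal_all indep gauss mI) lee_fin.
  apply: le_trans (one_sub_expr_ge m (e := K * expR (- (s ^+ 2 / 4))) _ _).
  - by rewrite lerD2l lerN2 s2; exact: (small_tail_le K0 (ltn0Sn m)).
  - rewrite fine_ge0//= -lee_fin fineK ?fin_num_measure//.
    exact: (@probability_le1 _ _ _ (normal_prob 0 1)).
  - by rewrite -lee_fin fineK ?fin_num_measure//; exact: itvcc.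
have PB : (P B <= (384 / k ^+ 4 / m.+1%:R ^+ 2)%:E)%E.
  rewrite (iid_normal_all indep gauss mJ) lee_fin.
  apply: le_trans (large_max_le k0 m0).
  rewrite -/L -t2; apply: exprn_le_expRN; first exact: fine_ge0.
  by rewrite -lee_fin fineK ?fin_num_measure//; exact: itvoo.
have entry w u : A w ->
    unit_leading_eigenvector (@Atilde m.+1 lam (fun j => g j w)) u ->
    forall i : 'I_m,
    `|g i w| / (4 * (lam 0%N - lam i.+1)) <= `|u (lift ord0 i) 0|.
  move=> Aw; apply: Assumption1_entry_ge => // i.
  rewrite -/L -s2 -(real_normK (num_real (g i w))) lerXn2r ?nnegrE//.
  by have := Aw i I; rewrite /= in_itv/= -ler_norml.
split.
  exists A; split=> //; split=> [|w Aw u eig i].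
    apply: le_trans PA; rewrite lee_fin lerD2l lerN2 ler_wpM2r ?invr_ge0 ?exprn_ge0//.
    by rewrite lerDl ltW.
  case: (unliftP ord0 i) => [j ->|->//] _.
  by rewrite lift0/= gext_ord; exact: entry.
exists (A `\` B); split; first exact: measurableD.
split=> [|w [Aw nBw] u eig].
  by rewrite mulrDl; exact: probability_setD_ge.
have [i ti] : exists i, t <= `|g i w|.
  apply: contrapT => /forallNP small; apply: nBw => i _ /=.
  by rewrite in_itv/= -ltr_norml ltNge; exact/negP/small.
exists (lift ord0 i); split; first by rewrite lift0.
have gap : 0 < lam 0%N - lam i.+1 by rewrite subr_gt0.
rewrite lift0 mulrC; have := entry w u Aw eig i.
rewrite ler_pdivrMr ?mulr_gt0// => h.
have -> : Num.sqrt L * 8^-1 = t / 4.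
  by rewrite /t -mulrA -invfM -natrM.
rewrite ler_pdivrMr// (le_trans ti)// (le_trans h)//.
by rewrite le_eqVlt; apply/orP; left; apply/eqP; clear; ring.
Qed.
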